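(* Let $s\leqslant k\leqslant s+m$, and assume that the trajectory $\theta(t)$ generated by the $k$-HiSD $$\left\{\begin{aligned}\dot{\theta} &= -\beta\Big(I-\sum_{p=1}^k 2v_pv_p^\top\Big)\nabla E(\theta),\\ \dot v_p &= -\zeta\Big(I-v_pv_p^\top-\sum_{q=1}^{p-1}2v_qv_q^\top\Big)\nabla^2E(\theta)v_p,\quad p=1,\dots,k,\end{aligned}\right.$$ (with $\beta,\zeta>0$ and $\{v_p(0)\}_{p=1}^k$ orthonormal) remains within $\mathcal{U}(\mathcal{M},\delta)$ for all $t\geqslant 0$. If there exists a constant $\alpha<\frac{3\mu^2}{64L^2}$ such that for any $t\geqslant 0$ the unstable directions $v_p(t)$ satisfy $$\left\|\sum_{p=1}^k v_p(t)v_p(t)^\top-\sum_{p=1}^s u_p(t)u_p(t)^\top-\sum_{p=s+1}^k w_p(t)w_p(t)^\top\right\|_2<\alpha,$$ where $\{w_p(t)\}_{p=s+1}^k$ are some orthonormal vectors in $U(t)$, then $\mathcal{M}$ is asymptotically stable and the trajectory $\theta(t)$ converges, as $t\to\infty$, to an index-$s$ saddle point in $\mathcal{M}$.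
   Context: Setting. $E:\mathbb{R}^d\to\mathbb{R}$ is a $\mathcal{C}^2$ function with bounded Hessian. $\mathcal{M}\subset\mathbb{R}^d$ is a closed, $\mathcal{C}^2$-embedded, connected, nondegenerate critical manifold of $E$ of dimension $m$ consisting of index-$s$ saddle points: every $\vartheta\in\mathcal{M}$ satisfies $\nabla E(\vartheta)=0$, $\nabla^2E(\vartheta)$ is nondegenerate on the normal space $N_\vartheta\mathcal{M}$ (equivalently $\operatorname{Ker}\nabla^2E(\vartheta)=T_\vartheta\mathcal{M}$), and $\nabla^2E(\vartheta)$ has exactly $s$ negative eigenvalues (counted with multiplicity). Notation. $\|\cdot\|_2$ is the Euclidean norm for vectors and the spectral norm for matrices. $\hat\theta=\mathcal{P}_{\mathcal{M}}(\theta)=\operatorname{arg\,min}_{\theta'\in\mathcal{M}}\|\theta-\theta'\|_2$ is the nearest-point projection. The eigenvalues of $\nabla^2E(\theta)$ in ascending order are $\lambda_1\leqslant\dots\leqslant\lambda_d$, with corresponding orthonormal eigenvectors $u_1,\dots,u_d$. Standing assumption. There exist a $\delta$-tubular neighborhood $\mathcal{U}(\mathcal{M},\delta)=\{\theta\in\mathbb{R}^d:\|\theta-\hat\theta\|_2<\delta\}$ and constants $M,L,\mu>0$ with $M\delta\leqslant\mu/4$ such that: (i) $\mathcal{P}_{\mathcal{M}}$ is well defined on $\mathcal{U}(\mathcal{M},\delta)$; (ii) $\|\nabla^2E(\theta)-\nabla^2E(\theta')\|_2\leqslant M\|\theta-\theta'\|_2$ for all $\theta,\theta'\in\mathcal{U}(\mathcal{M},\delta)$;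 (iii) for all $\theta\in\mathcal{U}(\mathcal{M},\delta)$, $\lambda_1,\dots,\lambda_s\in[-L,-\mu]$ and $\lambda_{s+m+1},\dots,\lambda_d\in[\mu,L]$. Along a trajectory $\theta(t)$, $u_1(t),\dots,u_d(t)$ denote orthonormal eigenvectors of $\nabla^2E(\theta(t))$ corresponding to its eigenvalues arranged in ascending order, and $U(t)=\operatorname{span}\{u_p(t)\}_{p=s+1}^{s+m}$. Asymptotic stability of the set $\mathcal{M}$ is meant with respect to the $\theta$-component of $k$-HiSD trajectories satisfying the hypotheses of the claim (with the given $\alpha$): for every $\varepsilon>0$ there is $\eta>0$ such that any such trajectory with $\operatorname{dist}(\theta(0),\mathcal{M})<\eta$ satisfies $\operatorname{dist}(\theta(t),\mathcal{M})<\varepsilon$ for all $t\geqslant0$, and $\operatorname{dist}(\theta(t),\mathcal{M})\to0$ as $t\to\infty$ for such trajectories starting sufficiently close to $\mathcal{M}$. *)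

(* Defs.v *)
From HB Require Import structures.
From mathcomp Require Import all_boot all_order all_algebra.
From mathcomp Require Import all_classical all_reals all_analysis.

Set Implicit Arguments.
Unset Strict Implicit.
Unset Printing Implicit Defensive.

Import Order.TTheory GRing.Theory Num.Theory.
Import numFieldNormedType.Exports.

Local Open Scope classical_set_scope.
Local Open Scope ring_scope.

(* The norm that the library puts on ['cV[R]_d] is the sup norm.  It is used
   below only through the topology and the derivatives it induces; every
   metric quantity is expressed with [l2norm]. *)

Section Euclidean.
Variables (R : realType).

Definition dotv d (x y : 'cV[R]_d) : R := \sum_i x i 0 * y i 0.

Definition l2norm d (x : 'cV[R]_d) : R := Num.sqrt (dotv x x).

Definition spectral_norm d (A : 'M[R]_d) : R :=
  sup [set l2norm (A *m x) | x in [set x | l2norm x <= 1]].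

Definition orthonormal_family d n (v : 'I_n -> 'cV[R]_d) : Prop :=
  forall i j, dotv (v i) (v j) = (i == j)%:R.

Definition dist_to d (S : set 'cV[R]_d) (x : 'cV[R]_d) : R :=
  inf [set l2norm (x - y) | y in S].

Definition is_nearest d (S : set 'cV[R]_d) (x y : 'cV[R]_d) : Prop :=
  S y /\ forall z, S z -> l2norm (x - y) <= l2norm (x - z).

Definition tube d (S : set 'cV[R]_d) (delta : R) : set 'cV[R]_d :=
  [set x | exists2 y, is_nearest S x y & l2norm (x - y) < delta].

End Euclidean.

Section Spectrum.
Variables (R : realType) (d : nat).
Implicit Types H : 'M[R]_d.

(* Ascending, with multiplicity.  The sequence is unique when [char_poly H]
   splits over [R], which is the case for every symmetric [H]; the default
   value [::] is only reached when [char_poly H] does not split. *)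
Definition eigvals H : seq R :=
  xget [::] [set l | sorted <=%R l /\ char_poly H = \prod_(x <- l) ('X - x%:P)].

Definition eigval H (i : 'I_d) : R := (eigvals H)`_i.

Definition morse_index H : nat := count (fun x : R => x < 0) (eigvals H).

Definition is_eigenbasis H (u : 'I_d -> 'cV[R]_d) : Prop :=
  orthonormal_family u /\ forall i, H *m u i = eigval H i *: u i.

End Spectrum.

Section Smoothness.
Variables (R : realType).

(* In finite dimension, continuity of x |-> Df(x) is the continuity of all
   directional derivatives x |-> Df(x) v. *)
Definition C1_on (V W : normedModType R) (A : set V) (f : V -> W) : Prop :=
  forall x, A x -> differentiable f x /\
    forall v, {for x, continuous (fun y => 'D_v f y)}.

Definition C2_on (V W : normedModType R) (A : set V) (f : V -> W) : Prop :=
  C1_on A f /\ forall v, C1_on A (fun y => 'D_v f y).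

Variable d : nat.
Implicit Types E : 'cV[R]_d -> R.

Definition partial (i : 'I_d) E (x : 'cV[R]_d) : R := 'D_(delta_mx i 0) E x.

Definition grad E (x : 'cV[R]_d) : 'cV[R]_d := \col_i partial i E x.

Definition hess E (x : 'cV[R]_d) : 'M[R]_d :=
  \matrix_(i, j) partial i (partial j E) x.

Definition index_saddle E (s : nat) (x : 'cV[R]_d) : Prop :=
  grad E x = 0 /\ morse_index (hess E x) = s.

End Smoothness.

Section Submanifold.
Variables (R : realType) (d : nat).
Implicit Types S : set 'cV[R]_d.

(* Local C^2 parametrization [phi : W -> S `&` V] around [x]: an injective
   immersion that is a homeomorphism onto [S `&` V], with inverse [psi]. *)
Definition local_parametrization (m : nat) S (x : 'cV[R]_d)
    (W : set 'cV[R]_m) (V : set 'cV[R]_d)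
    (phi : 'cV[R]_m -> 'cV[R]_d) (psi : 'cV[R]_d -> 'cV[R]_m) : Prop :=
  [/\ open W, open V & V x] /\
  [/\ C2_on W phi,
      forall y, W y -> injective ('d phi y : 'cV[R]_m -> 'cV[R]_d),
      phi @` W = S `&` V,
      forall y, W y -> psi (phi y) = y &
      {within S `&` V, continuous psi}].

Definition C2_embedded_submanifold (m : nat) S : Prop :=
  forall x, S x -> exists W V phi psi,
    @local_parametrization m S x W V phi psi.

(* Velocities at [x] of differentiable curves drawn on [S]. *)
Definition tangent_space S (x : 'cV[R]_d) : set 'cV[R]_d :=
  [set v | exists gamma : R -> 'cV[R]_d,
    [/\ gamma 0 = x,
        \forall t \near (0 : R), S (gamma t) /\ derivable gamma t 1 &
        is_derive (0 : R) 1 gamma v]].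

Definition normal_space S (x : 'cV[R]_d) : set 'cV[R]_d :=
  [set n | forall v, tangent_space S x v -> dotv n v = 0].

Definition nondegenerate_on (H : 'M[R]_d) (N : set 'cV[R]_d) : Prop :=
  forall n, N n -> (forall n', N n' -> dotv n (H *m n') = 0) -> n = 0.

Definition critical_saddle_manifold (E : 'cV[R]_d -> R) (s m : nat) S : Prop :=
  [/\ closed S, connected S, C2_embedded_submanifold m S &
      forall x, S x ->
        index_saddle E s x /\ nondegenerate_on (hess E x) (normal_space S x)].

Definition standing_assumption (E : 'cV[R]_d -> R) (s m : nat) S
    (delta M L mu : R) : Prop :=
  [/\ 0 < delta, 0 < M, 0 < L, 0 < mu & M * delta <= mu / 4] /\
  [/\ forall x, tube S delta x -> exists! y, is_nearest S x y,
      forall x y, tube S delta x -> tube S delta y ->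
        spectral_norm (hess E x - hess E y) <= M * l2norm (x - y) &
      forall x, tube S delta x -> forall i : 'I_d,
        ((i < s)%N -> - L <= eigval (hess E x) i <= - mu) /\
        ((s + m <= i)%N -> mu <= eigval (hess E x) i <= L)].

End Submanifold.

Section HiSD.
Variables (R : realType) (d : nat).
Implicit Types (E : 'cV[R]_d -> R) (S : set 'cV[R]_d).
Implicit Types (theta : R -> 'cV[R]_d).

(* Solutions on [0, +oo[: the equations hold for t > 0 and continuity at 0
   yields the one-sided equations there. *)
Definition kHiSD E (k : nat) (beta zeta : R) theta
    (v : 'I_k -> R -> 'cV[R]_d) : Prop :=
  [/\ {within `[0, +oo[, continuous theta},
      forall p, {within `[0, +oo[, continuous (v p)},
      forall t : R, 0 < t ->
        is_derive t 1 theta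
          (- beta *: ((1%:M - \sum_p 2 *: (v p t *m (v p t)^T))
                      *m grad E (theta t))),
      forall t : R, 0 < t -> forall p,
        is_derive t 1 (v p)
          (- zeta *: ((1%:M - v p t *m (v p t)^T
                       - \sum_(q < k | (q < p)%N) 2 *: (v q t *m (v q t)^T))
                      *m (hess E (theta t) *m v p t))) &
      orthonormal_family (fun p => v p 0)].

(* [v] is within [alpha], in spectral norm of projectors, of the span of the
   first [s] eigenvectors of [H] and of some [k - s] orthonormal vectors [w]
   of the span U of the eigenvectors number s+1, ..., s+m. *)
Definition directions_close (H : 'M[R]_d) (s m k : nat) (alpha : R)
    (v : 'I_k -> 'cV[R]_d) : Prop :=
  exists (u : 'I_d -> 'cV[R]_d) (w : 'I_(k - s) -> 'cV[R]_d),
    [/\ is_eigenbasis H u,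
        orthonormal_family w,
        forall p, exists c : 'I_d -> R,
          w p = \sum_(i < d | (s <= i < s + m)%N) c i *: u i &
        spectral_norm (\sum_p v p *m (v p)^T
                       - \sum_(i < d | (i < s)%N) u i *m (u i)^T
                       - \sum_p w p *m (w p)^T) < alpha].

Definition admissible_trajectory E S (s m k : nat)
    (delta beta zeta alpha : R) theta : Prop :=
  exists v : 'I_k -> R -> 'cV[R]_d,
    [/\ kHiSD E beta zeta theta v,
        forall t, 0 <= t -> tube S delta (theta t) &
        forall t, 0 <= t ->
          directions_close (hess E (theta t)) s m alpha (fun p => v p t)].

Definition asymptotically_stable S (traj : set (R -> 'cV[R]_d)) : Prop :=
  (forall eps : R, 0 < eps -> exists2 eta : R, 0 < eta &
     forall theta, traj theta -> dist_to S (theta 0) < eta ->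
       forall t, 0 <= t -> dist_to S (theta t) < eps) /\
  (exists2 eta : R, 0 < eta &
     forall theta, traj theta -> dist_to S (theta 0) < eta ->
       dist_to S (theta t) @[t --> +oo] --> (0 : R)).

End HiSD.

(* Main.v *)
Require Import Defs.
From mathcomp Require Import all_boot all_order all_algebra.
From mathcomp Require Import all_classical all_reals all_analysis.
From mathcomp Require Import ring lra.
Import Order.TTheory GRing.Theory Num.Theory.
Import numFieldNormedType.Exports.
Local Open Scope classical_set_scope.
Local Open Scope ring_scope.

(* The proof tracks r = theta - y, with y a nearest point of Mf, and
   H = hess E theta.  The point y has an m-dimensional space T of tangent
   vectors; r is orthogonal to T, and H is small on T because hess E y
   annihilates it.  Since the middle eigenspace of H has dimension at most m, it
   is close to T: hence the component of r in it is at most |r| / 3, and H is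
   small there.  The reflection I - 2 sum v v^T, close to the exact reflection
   through the negative eigenvectors and w, makes H coercive on the rest of r,
   so that the velocity satisfies <r, theta'> <= - (beta mu / 4) |r|^2.
   As dist(theta, Mf)^2 is touched from above by |theta - y|^2 with y frozen, it
   decays like exp(- beta mu t / 2); the speed is O(|r|), hence integrable, and
   theta converges. *)

(** * Euclidean geometry: inner product, spectral norm, reflections *)

Section EuclideanTheory.
Context {R : realType} {d : nat}.
Implicit Types (x y z : 'cV[R]_d) (A B : 'M[R]_d).

Lemma dotvC x y : dotv x y = dotv y x.
Proof. by apply: eq_bigr => i _; rewrite mulrC. Qed.

Lemma dotvDl x y z : dotv (x + y) z = dotv x z + dotv y z.
Proof. by rewrite -big_split; apply: eq_bigr => i _; rewrite mxE mulrDl. Qed.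

Lemma dotvDr x y z : dotv z (x + y) = dotv z x + dotv z y.
Proof. by rewrite !(dotvC z) dotvDl. Qed.

Lemma dotvZl c x y : dotv (c *: x) y = c * dotv x y.
Proof. by rewrite mulr_sumr; apply: eq_bigr => i _; rewrite mxE mulrA. Qed.

Lemma dotvZr c x y : dotv x (c *: y) = c * dotv x y.
Proof. by rewrite !(dotvC x) dotvZl. Qed.

Lemma dotv0l x : dotv 0 x = 0.
Proof. by rewrite -(scale0r 0) dotvZl mul0r. Qed.

Lemma dotv0r x : dotv x 0 = 0.
Proof. by rewrite dotvC dotv0l. Qed.

Lemma dotvNl x y : dotv (- x) y = - dotv x y.
Proof. by rewrite -scaleN1r dotvZl mulN1r. Qed.

Lemma dotvNr x y : dotv x (- y) = - dotv x y.
Proof. by rewrite -scaleN1r dotvZr mulN1r. Qed.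

Lemma dotvBl x y z : dotv (x - y) z = dotv x z - dotv y z.
Proof. by rewrite dotvDl dotvNl. Qed.

Lemma dotvBr x y z : dotv z (x - y) = dotv z x - dotv z y.
Proof. by rewrite dotvDr dotvNr. Qed.

Lemma dotv_suml (I : finType) (P : pred I) (F : I -> 'cV[R]_d) y :
  dotv (\sum_(i | P i) F i) y = \sum_(i | P i) dotv (F i) y.
Proof.
apply: (big_rec2 (fun a b => dotv a y = b)) => [|i a b _ <-]; first exact: dotv0l.
by rewrite dotvDl.
Qed.

Lemma dotv_sumr (I : finType) (P : pred I) (F : I -> 'cV[R]_d) y :
  dotv y (\sum_(i | P i) F i) = \sum_(i | P i) dotv y (F i).
Proof. by rewrite dotvC dotv_suml; apply: eq_bigr => i _; rewrite dotvC. Qed.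

Lemma dotvE x y : dotv x y = (x^T *m y) 0 0.
Proof. by rewrite mxE; apply: eq_bigr => i _; rewrite mxE. Qed.

Lemma dotv_mulmxr A x y : dotv x (A *m y) = dotv (A^T *m x) y.
Proof. by rewrite !dotvE trmx_mul trmxK mulmxA. Qed.

Lemma dotv_mulmxl A x y : dotv (A *m x) y = dotv x (A^T *m y).
Proof. by rewrite dotv_mulmxr trmxK. Qed.

Lemma trmxB A B : (A - B)^T = A^T - B^T.
Proof. by apply/matrixP => i j; rewrite !mxE. Qed.

Lemma dotv_delta x (i : 'I_d) : dotv x (delta_mx i 0) = x i 0.
Proof.
rewrite /dotv (bigD1 i) //= mxE !eqxx mulr1 big1 ?addr0 // => j ji.
by rewrite mxE (negbTE ji) mulr0.
Qed.

Lemma mul_col_trmx x y z : x *m y^T *m z = dotv y z *: x.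
Proof. by rewrite -mulmxA [y^T *m z]mx11_scalar mul_mx_scalar -dotvE. Qed.

Lemma dotvv_ge0 x : 0 <= dotv x x.
Proof. by apply: sumr_ge0 => i _; rewrite -expr2 sqr_ge0. Qed.

Lemma l2norm_ge0 x : 0 <= l2norm x.
Proof. exact: sqrtr_ge0. Qed.

Lemma l2norm_sqr x : l2norm x ^+ 2 = dotv x x.
Proof. by rewrite sqr_sqrtr // dotvv_ge0. Qed.

Lemma l2norm0 : l2norm (0 : 'cV[R]_d) = 0.
Proof. by rewrite /l2norm dotv0l sqrtr0. Qed.

Lemma coord_le_l2norm x (i : 'I_d) : `|x i 0| <= l2norm x.
Proof.
rewrite -ler_sqr ?nnegrE ?l2norm_ge0 // l2norm_sqr real_normK ?num_real //.
rewrite /dotv (bigD1 i) //= expr2 lerDl sumr_ge0 // => j _.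
by rewrite -expr2 sqr_ge0.
Qed.

Lemma l2norm_eq0 x : (l2norm x == 0) = (x == 0).
Proof.
apply/eqP/eqP => [x0|->]; last by rewrite /l2norm dotv0l sqrtr0.
apply/matrixP => i j; rewrite mxE ord1; apply/eqP.
by rewrite -normr_le0 -x0 coord_le_l2norm.
Qed.

Lemma l2normZ c x : l2norm (c *: x) = `|c| * l2norm x.
Proof. by rewrite /l2norm dotvZl dotvZr mulrA -expr2 sqrtrM ?sqr_ge0 // sqrtr_sqr. Qed.

Lemma l2normN x : l2norm (- x) = l2norm x.
Proof. by rewrite -scaleN1r l2normZ normrN1 mul1r. Qed.

Lemma l2normB x y : l2norm (x - y) = l2norm (y - x).
Proof. by rewrite -l2normN opprB. Qed.

Lemma cauchy_schwarz x y : `|dotv x y| <= l2norm x * l2norm y.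
Proof.
have [->|y0] := eqVneq y 0.
  by rewrite dotv0r normr0 mulr_ge0 ?l2norm_ge0.
have yy : 0 < dotv y y.
  by rewrite -l2norm_sqr exprn_gt0 // lt_def l2norm_eq0 y0 l2norm_ge0.
rewrite -ler_sqr ?nnegrE ?mulr_ge0 ?l2norm_ge0 // real_normK ?num_real //.
rewrite exprMn !l2norm_sqr -subr_ge0.
(* This square expands to <y,y> (<x,x> <y,y> - <x,y>^2). *)
have h := dotvv_ge0 (dotv y y *: x - dotv x y *: y).
rewrite -(pmulr_rge0 _ yy); apply: le_trans h _.
rewrite dotvBl !dotvBr !dotvZl !dotvZr (dotvC y x) le_eqVlt; apply/orP; left.
by apply/eqP; ring.
Qed.

Lemma l2normD x y : l2norm (x + y) <= l2norm x + l2norm y.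
Proof.
rewrite -ler_sqr ?nnegrE ?addr_ge0 ?l2norm_ge0 // sqrrD !l2norm_sqr.
rewrite dotvDl !dotvDr (dotvC y x).
by have := cauchy_schwarz x y; rewrite ler_norml => /andP[_]; lra.
Qed.

Lemma le_dotv x y : dotv x y <= l2norm x * l2norm y.
Proof. exact: le_trans (ler_norm _) (cauchy_schwarz _ _). Qed.

Lemma ge_dotv x y : - (l2norm x * l2norm y) <= dotv x y.
Proof. by have := cauchy_schwarz x y; rewrite ler_norml => /andP[]. Qed.

(** The supremum in [spectral_norm] is informative only over a bounded set; Cauchy-Schwarz on each
    row gives the Frobenius norm as a bound. *)
Lemma spectral_norm_has_ubound A :
  has_ubound [set l2norm (A *m x) | x in [set x | l2norm x <= 1]].
Proof.
exists (Num.sqrt (\sum_i l2norm (row i A)^T ^+ 2)) => _ [x /= x1 <-].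
rewrite ler_sqrt ?sumr_ge0 // => [|i _]; last exact: sqr_ge0.
apply: ler_sum => i _; rewrite -expr2.
have -> : (A *m x) i 0 = dotv (row i A)^T x.
  by rewrite mxE; apply: eq_bigr => j _; rewrite !mxE.
rewrite -(real_normK (num_real (dotv (row i A)^T x))) ler_sqr ?nnegrE ?l2norm_ge0 //.
by rewrite (le_trans (cauchy_schwarz _ _)) // ler_piMr ?l2norm_ge0.
Qed.

Lemma spectral_norm_ge0 A : 0 <= spectral_norm A.
Proof.
apply: (ub_le_sup (spectral_norm_has_ubound A)); exists 0 => /=.
  by rewrite l2norm0.
by rewrite mulmx0 l2norm0.
Qed.

Lemma l2norm_mulmx A x : l2norm (A *m x) <= spectral_norm A * l2norm x.
Proof.
have [->|x0] := eqVneq x 0.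
  by rewrite mulmx0 l2norm0 mulr0.
have nx : 0 < l2norm x by rewrite lt_def l2norm_eq0 x0 l2norm_ge0.
rewrite -ler_pdivrMr //.
apply: (ub_le_sup (spectral_norm_has_ubound A)); exists ((l2norm x)^-1 *: x) => /=.
  by rewrite l2normZ ger0_norm ?invr_ge0 ?l2norm_ge0 // mulVf ?gt_eqF.
by rewrite -scalemxAr l2normZ ger0_norm ?invr_ge0 ?l2norm_ge0 // mulrC.
Qed.

(** |A^T x|^2 = <x, A (A^T x)> is at most |A| |A^T x| |x|; divide by |A^T x|. *)
Lemma l2norm_trmx_mulmx A x : l2norm (A^T *m x) <= spectral_norm A * l2norm x.
Proof.
have [->|y0] := eqVneq (A^T *m x) 0.
  by rewrite l2norm0 mulr_ge0 ?spectral_norm_ge0 ?l2norm_ge0.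
have ny : 0 < l2norm (A^T *m x) by rewrite lt_def l2norm_eq0 y0 l2norm_ge0.
rewrite -(ler_pM2l ny) -expr2 l2norm_sqr -dotv_mulmxr dotvC.
apply: le_trans (le_dotv _ _) _; rewrite mulrA ler_wpM2r ?l2norm_ge0 //.
by rewrite mulrC l2norm_mulmx.
Qed.

Lemma cauchy_schwarz_mulmx A x y :
  `|dotv x (A *m y)| <= spectral_norm A * l2norm x * l2norm y.
Proof.
apply: le_trans (cauchy_schwarz _ _) _.
by rewrite [leRHS]mulrAC [leRHS]mulrC ler_wpM2l ?l2norm_ge0 ?l2norm_mulmx.
Qed.

(* The reflection [I - 2P] is an isometry, [P] being the orthogonal projector
   on the span of the [v i] with [S i]. *)
Lemma l2norm_reflect (I : finType) (S : pred I) (v : I -> 'cV[R]_d) x :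
  (forall i j, dotv (v i) (v j) = (i == j)%:R) ->
  l2norm (x - 2 *: \sum_(i | S i) dotv (v i) x *: v i) = l2norm x.
Proof.
move=> vo; congr (Num.sqrt _); set p := \sum_(i | S i) _.
have px : dotv p x = \sum_(i | S i) dotv (v i) x ^+ 2.
  by rewrite dotv_suml; apply: eq_bigr => i _; rewrite dotvZl.
have pp : dotv p p = \sum_(i | S i) dotv (v i) x ^+ 2.
  rewrite {1}/p dotv_suml; apply: eq_bigr => i Si; rewrite dotvZl; congr (_ * _).
  rewrite dotv_sumr (bigD1 i) //= dotvZr vo eqxx mulr1 big1 ?addr0 // => j /andP[_ ji].
  by rewrite dotvZr vo eq_sym (negbTE ji) mulr0.
by rewrite dotvBl !dotvBr !dotvZl !dotvZr (dotvC x) px pp; ring.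
Qed.

End EuclideanTheory.

(** * Orthonormal eigenbases and spectral projectors *)

Definition spectral_proj {R : realType} {d : nat} (u : 'I_d -> 'cV[R]_d)
  (S : pred 'I_d) : 'M[R]_d := \sum_(i | S i) u i *m (u i)^T.

Section Eigenbasis.
Context {R : realType} {d : nat} {u : 'I_d -> 'cV[R]_d}.
Hypothesis uo : orthonormal_family u.
Implicit Types (x y z : 'cV[R]_d).

(** The square matrix U with columns u j satisfies U^T U = 1, hence U U^T = 1: d orthonormal vectors
    in dimension d are complete. *)
Lemma orthonormal_basis_dotv x y :
  dotv x y = \sum_i dotv (u i) x * dotv (u i) y.
Proof.
pose U : 'M[R]_d := \matrix_(i, j) u j i 0.
have Ux z i : dotv (u i) z = (U^T *m z) i 0.
  by rewrite mxE; apply: eq_bigr => j _; rewrite !mxE.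
have UU : U *m U^T = 1%:M.
  apply: mulmx1C; apply/matrixP => i j; rewrite !mxE -(uo i j).
  by apply: eq_bigr => l _; rewrite !mxE.
have -> : dotv x y = dotv x (U *m U^T *m y) by rewrite UU mul1mx.
rewrite -mulmxA dotv_mulmxr.
by apply: eq_bigr => i _; rewrite !Ux.
Qed.

Lemma l2norm_basis x : l2norm x ^+ 2 = \sum_i dotv (u i) x ^+ 2.
Proof. by rewrite l2norm_sqr orthonormal_basis_dotv. Qed.

Lemma orthonormal_basis_inj x y :
  (forall i, dotv (u i) x = dotv (u i) y) -> x = y.
Proof.
move=> xy; apply/eqP; rewrite -subr_eq0 -l2norm_eq0 -sqrf_eq0 l2norm_basis.
by rewrite big1 // => i _; rewrite dotvBr xy subrr expr0n.
Qed.

Lemma orthonormal_basis_sum x : x = \sum_i dotv (u i) x *: u i.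
Proof.
apply: orthonormal_basis_inj => i; rewrite dotv_sumr (bigD1 i) //= dotvZr uo eqxx.
rewrite mulr1 big1 ?addr0 // => j ji.
by rewrite dotvZr uo eq_sym (negbTE ji) mulr0.
Qed.

Lemma eigen_coord {H : 'M[R]_d} {lam : 'I_d -> R} :
  (forall i, H *m u i = lam i *: u i) ->
  forall x i, dotv (u i) (H *m x) = lam i * dotv (u i) x.
Proof.
move=> Hu x i; rewrite {1}(orthonormal_basis_sum x) mulmx_sumr dotv_sumr (bigD1 i) //=.
rewrite -scalemxAr Hu !dotvZr uo eqxx mulr1 big1 ?addr0 1?mulrC // => j ji.
by rewrite -scalemxAr Hu !dotvZr uo eq_sym (negbTE ji) !mulr0.
Qed.

(** In the eigenbasis, <x, H y> is a diagonal form, hence symmetric in x and y. The symmetry of the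
    Hessian is obtained this way. *)
Lemma eigen_selfadjoint {H : 'M[R]_d} {lam : 'I_d -> R} :
  (forall i, H *m u i = lam i *: u i) -> H^T = H.
Proof.
move=> Hu; apply/matrixP => i j; rewrite mxE.
have HE (i' j' : 'I_d) : H i' j' = dotv (delta_mx i' 0) (H *m delta_mx j' 0).
  by rewrite dotvC dotv_delta -colE mxE.
rewrite !HE !orthonormal_basis_dotv; apply: eq_bigr => l _.
by rewrite !(eigen_coord Hu); ring.
Qed.

Lemma spectral_projE S x : spectral_proj u S *m x = \sum_(i | S i) dotv (u i) x *: u i.
Proof. by rewrite mulmx_suml; apply: eq_bigr => i _; rewrite mul_col_trmx. Qed.

Lemma spectral_proj_coord S x i :
  dotv (u i) (spectral_proj u S *m x) = if S i then dotv (u i) x else 0.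
Proof.
rewrite spectral_projE dotv_sumr; case: ifPn => Si.
  rewrite (bigD1 i) //= dotvZr uo eqxx mulr1 big1 ?addr0 // => j /andP[_ ji].
  by rewrite dotvZr uo eq_sym (negbTE ji) mulr0.
rewrite big1 // => j Sj; rewrite dotvZr uo; case: eqP => [ij|_]; last by rewrite mulr0.
by rewrite ij Sj in Si.
Qed.

(** The projector is a sum of rank-one terms, one for each index in the window. This is only an
    upper bound, as s + m may exceed d. *)
Lemma rank_spectral_proj (s m : nat) :
  (\rank (spectral_proj u [pred i : 'I_d | s <= i < s + m]%N) <= m)%N.
Proof.
set S := [pred i : 'I_d | _]; apply: (@leq_trans (\sum_(i < d | S i) 1)).
  rewrite /spectral_proj; apply: (big_rec2 (fun (X : 'M[R]_d) n => \rank X <= n)%N).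
    by rewrite mxrank0.
  move=> i n X _ Xn; apply: leq_trans (mxrank_add _ _) _; apply: leq_add => //.
  by apply: leq_trans (mxrankM_maxl _ _) (rank_leq_col _).
rewrite sum1_card -[leqRHS](size_iota s) cardE -(size_map val).
apply: uniq_leq_size; first by rewrite map_inj_uniq ?enum_uniq //; exact: val_inj.
by move=> _ /mapP[i + ->]; rewrite mem_enum mem_iota.
Qed.

End Eigenbasis.

(** * Coercivity of the exactly reflected Hessian on a normal displacement *)

(* [D] is a frame of the tangent space of the critical manifold at the nearest
   point of [theta], and [r] is the corresponding normal displacement. *)
Section SaddleReflection.
Context {R : realType} {d : nat} {s m n : nat} {H : 'M[R]_d} {L mu : R}.
Context {u : 'I_d -> 'cV[R]_d} {lam : 'I_d -> R}.
Context {w : 'I_n -> 'cV[R]_d} {D : 'M[R]_(d, m)} {r : 'cV[R]_d}.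
Hypotheses (L_gt0 : 0 < L) (mu_gt0 : 0 < mu).
Hypotheses (uo : orthonormal_family u) (Hu : forall i, H *m u i = lam i *: u i).
Hypothesis lam_lo : forall i : 'I_d, (i < s)%N -> - L <= lam i <= - mu.
Hypothesis lam_hi : forall i : 'I_d, (s + m <= i)%N -> mu <= lam i <= L.
Hypothesis wo : orthonormal_family w.
Hypothesis w_mid : forall p, exists c : 'I_d -> R,
  w p = \sum_(i < d | (s <= i < s + m)%N) c i *: u i.
Hypothesis D_inj : forall y : 'cV[R]_m, D *m y = 0 -> y = 0.
Hypothesis rD : forall y : 'cV[R]_m, dotv r (D *m y) = 0.
Hypothesis HD : forall y : 'cV[R]_m, l2norm (H *m (D *m y)) <= mu / 4 * l2norm (D *m y).

Let mid := [pred i : 'I_d | s <= i < s + m]%N.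
Let Pc := spectral_proj u mid.
Let a i := dotv (u i) r.

Lemma midPn (i : 'I_d) : ~~ mid i -> (i < s)%N \/ (s + m <= i)%N.
Proof. by rewrite /mid /= negb_and -ltnNge -leqNgt => /orP. Qed.

Lemma lam_out_sqr (i : 'I_d) : ~~ mid i -> mu ^+ 2 <= lam i ^+ 2 <= L ^+ 2.
Proof.
have [m0 L0] := (mu_gt0, L_gt0); case/midPn => [/lam_lo|/lam_hi] /andP[l1 l2].
  by rewrite -(sqrrN (lam i)); apply/andP; split; rewrite ler_sqr ?nnegrE; lra.
by apply/andP; split; rewrite ler_sqr ?nnegrE; lra.
Qed.

(** Outside [mid], |lam i| >= mu, so H stretches each of those coordinates by at least mu. *)
Lemma mid_defect x : mu * l2norm (x - Pc *m x) <= l2norm (H *m x).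
Proof.
rewrite -ler_sqr ?nnegrE ?mulr_ge0 ?l2norm_ge0 ?(ltW mu_gt0) // exprMn.
rewrite !(l2norm_basis uo) mulr_sumr; apply: ler_sum => i _.
rewrite dotvBr (eigen_coord uo Hu) (spectral_proj_coord uo) exprMn.
case: ifPn => [_|/lam_out_sqr/andP[h _]]; last by rewrite subr0 ler_wpM2r ?sqr_ge0.
by rewrite subrr expr0n mulr0 mulr_ge0 ?sqr_ge0.
Qed.

Lemma mid_defectD y : l2norm (D *m y - Pc *m (D *m y)) <= l2norm (D *m y) / 4.
Proof.
rewrite -(ler_pM2l mu_gt0); apply: le_trans (mid_defect _) (le_trans (HD y) _).
by rewrite mulrAC -mulrA.
Qed.

(* Both [range D] and the middle eigenspace have dimension at most [m], and
   [Pc] is injective on the former, which has dimension [m]. *)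
Lemma Pc_surj : exists y, Pc *m (D *m y) = Pc *m r.
Proof.
(* Transposes are used because row spaces then stand for the ranges of the original matrices. *)
have PD_free : row_free (Pc *m D)^T.
  apply: inj_row_free => v vPD.
  have e : Pc *m (D *m v^T) = 0.
    by apply: trmx_inj; rewrite mulmxA trmx_mul trmxK vPD trmx0.
  have := mid_defectD v^T; rewrite e subr0 => le4.
  suff : v^T = 0 by move/(congr1 trmx); rewrite trmxK trmx0.
  apply: D_inj; apply/eqP; rewrite -l2norm_eq0.
  by apply/eqP; have := l2norm_ge0 (D *m v^T); lra.
have sub : ((Pc *m D)^T <= Pc^T)%MS by rewrite trmx_mul submxMl.
have rk := mxrankS sub; rewrite (eqP PD_free) in rk.
have rPc : (\rank Pc^T <= m)%N by rewrite mxrank_tr rank_spectral_proj.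
(* The smaller space has dimension m and the larger at most m, so the inclusion is an equality. *)
have : (Pc^T <= (Pc *m D)^T)%MS.
  by rewrite -(mxrank_leqif_sup sub) (eqP PD_free) eqn_leq rk rPc.
move=> /(submx_trans (submxMl r^T _))/submxP[v e].
exists v^T; apply: trmx_inj; rewrite mulmxA trmx_mul trmxK -e.
by rewrite trmx_mul.
Qed.

(** Let q = Pc r, and t in the range of D with Pc t = q. Then |t - q| <= |t| / 4, so |t| <= 4/3 |q|.
    As r is orthogonal to t, |q|^2 = <q - t, r> <= |q| |r| / 3. As Pc commutes with H, |H q| = |Pc H
    t| <= mu/4 |t| <= mu/3 |q|. *)
Lemma mid_part_small :
  l2norm (Pc *m r) <= l2norm r / 3 /\
  l2norm (H *m (Pc *m r)) <= mu / 3 * l2norm (Pc *m r).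
Proof.
have [y yq] := Pc_surj; set q := Pc *m r in yq *; set t := D *m y in yq.
have tq : l2norm (t - q) <= l2norm t / 4 by rewrite -yq mid_defectD.
have t_le : l2norm t <= 4 / 3 * l2norm q.
  by have := l2normD (t - q) q; rewrite subrK; lra.
have PcH : forall x : 'cV[R]_d, l2norm (Pc *m x) <= l2norm x.
  move=> x; rewrite -ler_sqr ?nnegrE ?l2norm_ge0 // !(l2norm_basis uo).
  apply: ler_sum => i _; rewrite (spectral_proj_coord uo).
  by case: ifP => _ //; rewrite expr0n sqr_ge0.
have HPc : forall x : 'cV[R]_d, H *m (Pc *m x) = Pc *m (H *m x).
  move=> x; apply: (orthonormal_basis_inj uo) => i.
  rewrite (eigen_coord uo Hu) !(spectral_proj_coord uo) (eigen_coord uo Hu).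
  by case: ifP => _ //; rewrite mulr0.
split; last first.
  rewrite -yq HPc; apply: le_trans (PcH _) (le_trans (HD y) _); rewrite yq -/t.
  by have := ler_wpM2l (ltW mu_gt0) t_le; lra.
have qq : l2norm q ^+ 2 <= l2norm q * (l2norm r / 3).
  have -> : l2norm q ^+ 2 = dotv (q - t) r.
    rewrite dotvBl (dotvC t) rD subr0 (l2norm_basis uo) (orthonormal_basis_dotv uo).
    apply: eq_bigr => i _; rewrite (spectral_proj_coord uo); case: ifP => _ //.
    by rewrite mul0r expr0n.
  apply: le_trans (le_dotv _ _) _; rewrite l2normB mulrA [leRHS]mulrAC.
  by rewrite ler_wpM2r ?l2norm_ge0 //; lra.
have [q0|qn0] := eqVneq (l2norm q) 0; first by rewrite q0 divr_ge0 ?l2norm_ge0.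
by rewrite -(ler_pM2l (_ : 0 < l2norm q)) ?lt_def ?qn0 ?l2norm_ge0.
Qed.

Lemma l2norm_split_mid :
  l2norm r ^+ 2 = l2norm (Pc *m r) ^+ 2 + \sum_(i | ~~ mid i) a i ^+ 2.
Proof.
rewrite !(l2norm_basis uo) (bigID mid) /=; congr (_ + _).
rewrite [RHS](bigID mid) /= [X in _ = _ + X]big1 ?addr0 => [|i /negbTE mi].
  by apply: eq_bigr => i mi; rewrite (spectral_proj_coord uo) /= mi.
by rewrite (spectral_proj_coord uo) /= mi expr0n.
Qed.

(** A nonzero r has a nonzero component outside [mid], hence some eigenvalue there has mu <= |lam i|
    <= L. The sum weighted by [a i ^+ 2] avoids choosing one. *)
Lemma mu_le_L : r != 0 -> mu <= L.
Proof.
move=> r0; have [q1 _] := mid_part_small.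
have rgt0 : 0 < l2norm r by rewrite lt_def l2norm_eq0 r0 l2norm_ge0.
have q1' : l2norm (Pc *m r) ^+ 2 <= l2norm r ^+ 2 / 9.
  have := lerXn2r 2 _ _ q1; rewrite !nnegrE l2norm_ge0 divr_ge0 ?(ltW rgt0) //.
  by move=> /(_ erefl erefl); lra.
have out_gt0 : 0 < \sum_(i | ~~ mid i) a i ^+ 2.
  by have := exprn_gt0 2 rgt0; have := l2norm_split_mid; lra.
rewrite -ler_sqr ?nnegrE ?(ltW L_gt0) ?(ltW mu_gt0) // -(ler_pM2r out_gt0) !mulr_sumr.
apply: ler_sum => i /lam_out_sqr/andP[h1 h2].
by rewrite ler_wpM2r ?sqr_ge0 // (le_trans h1 h2).
Qed.

(** Only the outer eigenvalues are bounded by L; on the middle part, |H q| <= mu/3 |q| together with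
    mu <= L does the same job. *)
Lemma l2norm_eigen_mulmx : l2norm (H *m r) <= L * l2norm r.
Proof.
have [m0 L0] := (mu_gt0, L_gt0); have [_ q2] := mid_part_small.
have rsplit := l2norm_split_mid.
have [r0|/mu_le_L mL] := eqVneq r 0; first by rewrite r0 mulmx0 l2norm0 mulr0.
have q_ge0 := l2norm_ge0 (Pc *m r).
rewrite -ler_sqr ?nnegrE ?mulr_ge0 ?l2norm_ge0 ?(ltW L_gt0) // exprMn.
have -> : l2norm (H *m r) ^+ 2 =
    l2norm (H *m (Pc *m r)) ^+ 2 + \sum_(i | ~~ mid i) lam i ^+ 2 * a i ^+ 2.
  rewrite !(l2norm_basis uo) (bigID mid) /=; congr (_ + _).
    rewrite [RHS](bigID mid) /= [X in _ = _ + X]big1 ?addr0 => [|i /negbTE mi].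
      apply: eq_bigr => i mi.
      by rewrite !(eigen_coord uo Hu) (spectral_proj_coord uo) /= mi.
    by rewrite (eigen_coord uo Hu) (spectral_proj_coord uo) /= mi mulr0 expr0n.
  by apply: eq_bigr => i _; rewrite (eigen_coord uo Hu) exprMn.
rewrite rsplit mulrDr; apply: lerD.
  rewrite -exprMn ler_sqr ?nnegrE ?mulr_ge0 ?l2norm_ge0 ?(ltW L_gt0) //.
  by apply: le_trans q2 _; rewrite ler_wpM2r //; lra.
by rewrite mulr_sumr; apply: ler_sum => i /lam_out_sqr/andP[_ h]; rewrite ler_wpM2r ?sqr_ge0.
Qed.

Let Pw := \sum_p w p *m (w p)^T.
Let Ps := \sum_(i < d | (i < s)%N) u i *m (u i)^T.

Lemma w_coord_out p (i : 'I_d) : ~~ mid i -> dotv (u i) (w p) = 0.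
Proof.
move=> mi; have [c ->] := w_mid p; rewrite dotv_sumr big1 // => j mj.
rewrite dotvZr uo; case: eqP => [ij|_]; last by rewrite mulr0.
by rewrite ij /= mj in mi.
Qed.

Lemma dotv_w_proj p x : dotv (w p) (Pc *m x) = dotv (w p) x.
Proof.
rewrite !(orthonormal_basis_dotv uo (w p)); apply: eq_bigr => i _.
rewrite (spectral_proj_coord uo); case: ifPn => // mi.
by rewrite w_coord_out // !mul0r.
Qed.

Lemma saddle_reflectE : (1%:M - 2 *: (Ps + Pw)) *m r =
  r - 2 *: (\sum_(i < d | (i < s)%N) a i *: u i) - 2 *: \sum_p dotv (w p) r *: w p.
Proof.
rewrite mulmxBl mul1mx -scalemxAl mulmxDl scalerDr opprD addrA.
rewrite spectral_projE mulmx_suml; congr (_ - _ - _ *: _).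
by apply: eq_bigr => p _; rewrite mul_col_trmx.
Qed.

(** Each w p is orthogonal to the u i with i < s, so its coefficient is unchanged by the first
    reflection: the map is a composition of two isometric reflections. *)
Lemma l2norm_saddle_reflect : l2norm ((1%:M - 2 *: (Ps + Pw)) *m r) = l2norm r.
Proof.
rewrite saddle_reflectE; set x := r - _.
have -> : \sum_p dotv (w p) r *: w p = \sum_p dotv (w p) x *: w p.
  apply: eq_bigr => p _; congr (_ *: _); rewrite /x dotvBr dotvZr dotv_sumr.
  rewrite big1 ?mulr0 ?subr0 // => i ilt; rewrite dotvZr dotvC w_coord_out ?mulr0 //.
  by rewrite /= leqNgt ilt.
by rewrite (l2norm_reflect _ xpredT) // (l2norm_reflect _ (fun i : 'I_d => i < s)%N).
Qed.

(* The middle part [q] of [r] satisfies |q| <= |r| / 3 and |H q| <= mu |q| / 3, so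
   it costs 1/9 + 1/27, whence 23/27. *)
Lemma saddle_reflect_coercive :
  23 / 27 * mu * l2norm r ^+ 2 <= dotv (H *m r) ((1%:M - 2 *: (Ps + Pw)) *m r).
Proof.
have [m0 L0] := (mu_gt0, L_gt0); have [q1 q2] := mid_part_small.
have q_ge0 := l2norm_ge0 (Pc *m r).
set q := Pc *m r in q1 q2 q_ge0.
have rsplit := l2norm_split_mid.
(* The reflection turns lam i into |lam i| outside [mid]; on the middle part it is the reflection of
   q through w, namely [z]. *)
pose z := q - 2 *: \sum_p dotv (w p) q *: w p.
have -> : dotv (H *m r) ((1%:M - 2 *: (Ps + Pw)) *m r) =
    dotv (H *m q) z + \sum_(i | ~~ mid i) `|lam i| * a i ^+ 2.
  rewrite saddle_reflectE !(orthonormal_basis_dotv uo (H *m _)) (bigID mid) /=.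
  congr (_ + _).
    rewrite [RHS](bigID mid) /= [X in _ = _ + X]big1 ?addr0 => [|i /negbTE mi]; last first.
      by rewrite (eigen_coord uo Hu) (spectral_proj_coord uo) /= mi mulr0 mul0r.
    apply: eq_bigr => i mi; rewrite !(eigen_coord uo Hu) (spectral_proj_coord uo) /= mi.
    congr (_ * _); rewrite !dotvBr (spectral_proj_coord uo) /= mi.
    rewrite -(spectral_projE (fun i : 'I_d => i < s)%N) dotvZr (spectral_proj_coord uo).
    rewrite ifN -?leqNgt ?(andP mi).1 // mulr0 subr0; congr (_ - _).
    congr (dotv _ (_ *: _)); apply: eq_bigr => p _; congr (_ *: _).
    by rewrite dotv_w_proj.
  apply: eq_bigr => i mi; rewrite (eigen_coord uo Hu) !dotvBr !dotvZr.
  have -> : dotv (u i) (\sum_p dotv (w p) r *: w p) = 0.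
    by rewrite dotv_sumr big1 // => p _; rewrite dotvZr w_coord_out ?mulr0.
  rewrite -(spectral_projE (fun i : 'I_d => i < s)%N) (spectral_proj_coord uo) -/(a i).
  have [ilt|ige] := midPn i mi.
    have /andP[l1 l2] := lam_lo i ilt.
    by rewrite ilt ltr0_norm; [ring|lra].
  have /andP[l1 l2] := lam_hi i ige.
  by rewrite ltnNge (leq_trans (leq_addr m s) ige) ger0_norm; [rewrite /=; ring|lra].
have zq : l2norm z = l2norm q by rewrite /z (l2norm_reflect _ xpredT).
have h1 : - (mu / 3 * l2norm q ^+ 2) <= dotv (H *m q) z.
  apply: le_trans (ge_dotv _ _); rewrite zq lerN2 expr2 mulrA.
  by rewrite ler_wpM2r.
have h2 : mu * \sum_(i | ~~ mid i) a i ^+ 2 <= \sum_(i | ~~ mid i) `|lam i| * a i ^+ 2.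
  rewrite mulr_sumr; apply: ler_sum => i mi; rewrite ler_wpM2r ?sqr_ge0 //.
  case: (midPn i mi) => [/lam_lo|/lam_hi] /andP[l1 l2].
    by rewrite ltr0_norm; lra.
  by rewrite ger0_norm; lra.
have q1' : l2norm q ^+ 2 <= l2norm r ^+ 2 / 9.
  by have := lerXn2r 2 _ _ q1; rewrite !nnegrE q_ge0 divr_ge0 ?l2norm_ge0 // => /(_ erefl erefl); lra.
have e : \sum_(i | ~~ mid i) a i ^+ 2 = l2norm r ^+ 2 - l2norm q ^+ 2 by rewrite rsplit; ring.
rewrite e in h2; have := ler_wpM2l (ltW mu_gt0) q1'; lra.
Qed.

End SaddleReflection.

(** * Derivatives along curves and a mean value formula for the gradient *)

Section Calculus.
Context {R : realType}.

Lemma is_derive_comp_line {V W : normedModType R} {f : V -> W} {g : R -> V} {t : R} {v : V} :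
  differentiable f (g t) -> is_derive t 1 g v ->
  is_derive t 1 (f \o g) ('D_v f (g t)).
Proof.
move=> df [dg <-].
have dg' : differentiable g t by apply/derivable1_diffP.
have dfg : differentiable (f \o g) t by apply: differentiable_comp.
apply: DeriveDef; first exact: diff_derivable.
by rewrite !deriveE // diff_comp.
Qed.

Lemma is_derive_affine {V : normedModType R} (y r : V) (t : R) :
  is_derive t 1 (fun h : R => y + h *: r) r.
Proof.
have d1 : is_derive t 1 ( *:%R ^~ r : R -> V) r.
  apply: DeriveDef; first exact: diff_derivable.
  by rewrite deriveE // diff_val scale1r.
by have := is_deriveD (is_derive_cst y t 1) d1; rewrite add0r.
Qed.

(** The derivative is the limit of right difference quotients, which are eventually at least
    sigma. *)
Lemma derive_right_ge (f : R -> R) (c l sigma : R) :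
  is_derive c 1 f l ->
  (\forall h \near 0^'+, f c + sigma * h <= f (c + h)) -> sigma <= l.
Proof.
move=> [df <-] fh; rewrite ['D_1 f c]cvg_at_rightE //.
apply: limr_ge.
  rewrite -(cvg_at_rightE (fun h : R => h^-1 *: ((f \o shift c) _ - f c))) //.
  apply: cvg_trans df; apply: cvg_app.
  move=> A [e egt0 Ae]; exists e => // x xe xgt0; apply: Ae => //.
  exact/lt0r_neq0.
near=> h; have h0 : 0 < h by near: h; exact: nbhs_right_gt.
rewrite [_%:A]mulr1 -[_ *: _]/(_ * _) mulrC ler_pdivlMr //= lerBrDl (addrC h).
by near: h.
Unshelve. all: by end_near. Qed.

Context {d : nat}.
Implicit Types (x y z r v : 'cV[R]_d) (E : 'cV[R]_d -> R).

Lemma col_sum_delta r : r = \sum_i r i 0 *: delta_mx i 0.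
Proof.
rewrite {1}[r]matrix_sum_delta; apply: eq_bigr => i _; rewrite big_ord1; congr (_ *: _).
Qed.

Lemma derive_sum_partial E x v : differentiable E x ->
  'D_v E x = \sum_i v i 0 * partial i E x.
Proof.
move=> dE; rewrite deriveE // {1}(col_sum_delta v) linear_sum; apply: eq_bigr => i _.
by rewrite linearZ /= /partial deriveE.
Qed.

Lemma is_derive_dotvr (g : R -> 'cV[R]_d) (t : R) v z :
  is_derive t 1 g v -> is_derive t 1 (fun t => dotv z (g t)) (dotv z v).
Proof.
move=> dg; pose h (i : 'I_d) := z i 0 *: (fun t => g t i 0).
have -> : (fun t => dotv z (g t)) = \sum_i h i.
  by apply/funext => u; rewrite fct_sumE.
apply: is_derive_sum => i; apply: is_deriveZ.
case: dg => dg <-; apply: DeriveDef; first by move/derivable_mxP : dg; exact.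
by rewrite derive_mx // mxE.
Qed.

Lemma is_derive_coord (g : R -> 'cV[R]_d) (t : R) v i :
  is_derive t 1 g v -> is_derive t 1 (fun t => g t i 0) (v i 0).
Proof.
case => dg <-; apply: DeriveDef; first by move/derivable_mxP : dg; exact.
by rewrite derive_mx // mxE.
Qed.

Lemma is_derive_l2norm_sqr (g : R -> 'cV[R]_d) (t : R) v :
  is_derive t 1 g v ->
  is_derive t 1 (fun t => l2norm (g t) ^+ 2) (2 * dotv (g t) v).
Proof.
move=> dg; pose h (i : 'I_d) := (fun t => g t i 0) ^+ 2.
have -> : (fun t => l2norm (g t) ^+ 2) = \sum_i h i.
  by apply/funext => u; rewrite fct_sumE l2norm_sqr.
have -> : 2 * dotv (g t) v = \sum_i (2%:R * g t i 0 ^+ 1) *: v i 0.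
  by rewrite mulr_sumr; apply: eq_bigr => i _; rewrite expr1 mulrA.
by apply: is_derive_sum => i; apply: is_deriveX; apply: is_derive_coord.
Qed.

Lemma C2_partial_differentiable E x i : C2_on setT E -> differentiable (partial i E) x.
Proof. by move=> [_ /(_ (delta_mx i 0) x I)[]]. Qed.

(** Testing the gradient against a fixed z reduces to the scalar mean value theorem, so tau depends
    on z. The vector r stands on the left because the first index of [hess] is the outer
    derivative. *)
Lemma grad_mvt E y r z : C2_on setT E -> exists2 tau : R, 0 <= tau <= 1 &
  dotv z (grad E (y + r)) - dotv z (grad E y) =
  dotv r (hess E (y + tau *: r) *m z).
Proof.
move=> E2; pose g t := dotv z (grad E (y + t *: r)).
have dg (t : R) : is_derive t 1 g (dotv r (hess E (y + t *: r) *m z)).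
  have -> : dotv r (hess E (y + t *: r) *m z) =
      dotv z (\col_j 'D_r (partial j E) (y + t *: r)).
    rewrite dotv_mulmxr dotvC; apply: eq_bigr => j _; congr (_ * _).
    rewrite !mxE derive_sum_partial; last exact: C2_partial_differentiable.
    by apply: eq_bigr => i _; rewrite !mxE mulrC.
  apply: is_derive_dotvr.
  have dp j := is_derive_comp_line (C2_partial_differentiable E (y + t *: r) j E2)
    (is_derive_affine y r t).
  have gradE i j : (fun h : R => grad E (y + h *: r) i j) =
      partial i E \o (fun h : R => y + h *: r).
    by apply/funext => h; rewrite mxE.
  have dd : derivable (fun t : R => grad E (y + t *: r)) t 1.
    by apply/derivable_mxP => i j; rewrite gradE; have [] := dp i.
  apply: DeriveDef => //; rewrite derive_mx //; apply/matrixP => i j.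
  by rewrite mxE gradE [RHS]mxE; have [_ ->] := dp i.
have gc : {within `[0, 1], continuous g}.
  by apply: derivable_within_continuous => t _; have [] := dg t.
have [tau t01 e] := MVT_segment (@ler01 R) (fun t _ => dg t) gc.
exists tau; first by move: t01; rewrite in_itv.
by move: e; rewrite /g subr0 mulr1 scale1r scale0r addr0.
Qed.

End Calculus.

(** * Tangent vectors and nearest points of the manifold *)

Section Manifold.
Context {R : realType} {d m : nat} {E : 'cV[R]_d -> R} {S : set 'cV[R]_d}.
Implicit Types (x y z v : 'cV[R]_d).

(** D is the Jacobian of a local parametrization at the preimage y0 of y: injective by immersion,
    with D w the velocity of t |-> phi (y0 + t w). *)
Lemma tangent_frame y : C2_embedded_submanifold m S -> S y ->
  exists D : 'M[R]_(d, m), (forall w : 'cV_m, D *m w = 0 -> w = 0) /\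
    forall w, tangent_space S y (D *m w).
Proof.
move=> + Sy => /(_ y Sy)[W [V [phi [psi [[oW oV Vy] [[phi1 _] phi_inj phiW _ _]]]]]].
have [y0 Wy0 phiy0] : (phi @` W) y by rewrite phiW.
pose D : 'M[R]_(d, m) := \matrix_(i, j) ('d phi y0 (delta_mx j 0) : 'cV[R]_d) i 0.
have DE w : D *m w = 'd phi y0 w.
  rewrite [w in RHS]col_sum_delta linear_sum; apply/matrixP => i j.
  rewrite ord1 mxE summxE; apply: eq_bigr => l _.
  by rewrite linearZ /= !mxE mulrC.
exists D; split=> [w|w].
  rewrite DE => w0; apply: (phi_inj _ Wy0); rewrite w0.
  by rewrite linear0.
have Wg : \forall t \near (0 : R), W (y0 + t *: w).
  have dc : differentiable (fun t : R => y0 + t *: w) 0.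
    by apply/derivable1_diffP; have [] := is_derive_affine y0 w 0.
  apply: (differentiable_continuous dc); rewrite /= scale0r addr0.
  exact: open_nbhs_nbhs.
exists (phi \o (fun t : R => y0 + t *: w)); split.
- by rewrite /= scale0r addr0.
- near=> t.
  have Wt : W (y0 + t *: w) by near: t.
  split.
    by have [] : (S `&` V) (phi (y0 + t *: w)) by rewrite -phiW; exists (y0 + t *: w).
  have [dphi _] := phi1 _ Wt.
  by have [] := is_derive_comp_line dphi (is_derive_affine y0 w t).
- have dphi : differentiable phi (y0 + 0 *: w) by rewrite scale0r addr0; have [] := phi1 _ Wy0.
  have := is_derive_comp_line dphi (is_derive_affine y0 w 0).
  by rewrite deriveE // scale0r addr0 -DE.
Unshelve. all: by end_near. Qed.

(** |x - gam t|^2 is least at t = 0, so its derivative there, -2 <x - y, v>, is nonnegative. Used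
    with v and -v, this gives orthogonality. *)
Lemma nearest_dotv_tangent x y v : is_nearest S x y -> tangent_space S y v ->
  dotv (x - y) v <= 0.
Proof.
move=> [Sy ymin] [gam [g0 gS dg]].
have dg' : is_derive (0 : R) 1 (fun t => x - gam t) (- v).
  by have := is_deriveB (is_derive_cst x (0 : R) 1) dg; rewrite sub0r.
have : 0 <= 2 * dotv (x - gam 0) (- v).
  apply: (derive_right_ge _ _ _ _ (is_derive_l2norm_sqr _ _ _ dg')).
  have : \forall h \near 0^'+, S (gam h).
    by apply: cvg_within; apply: filterS gS => ? [].
  apply: filterS => h Sh; rewrite mul0r addr0 add0r g0.
  by rewrite ler_sqr ?nnegrE ?l2norm_ge0 // ymin.
by rewrite g0 dotvNr; lra.
Qed.

(** Each [partial j E] vanishes along a curve on S, hence so does its derivative. The transpose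
    again comes from the index order in [hess]. *)
Lemma hess_tangent y v : C2_on setT E -> (forall z, S z -> grad E z = 0) ->
  tangent_space S y v -> (hess E y)^T *m v = 0.
Proof.
move=> E2 crit [gam [g0 gS dg]]; apply/matrixP => j i; rewrite ord1 !mxE.
have [_] := is_derive_comp_line (C2_partial_differentiable E (gam 0) j E2) dg.
rewrite g0 derive_sum_partial; last exact: C2_partial_differentiable.
move=> e; transitivity ('D_1 (partial j E \o gam) 0).
  by rewrite e; apply: eq_bigr => l _; rewrite !mxE mulrC.
rewrite (@near_eq_derive _ _ _ _ (cst 0)) ?derive_cst //.
apply: filterS gS => t [St _] /=.
by have /matrixP/(_ j 0) := crit _ St; rewrite !mxE.
Qed.

(** Subtract (1 - tau) |x - y| from |x - y| <= |x - z|. This keeps the segment in the tube, where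
    the Hessian is Lipschitz. *)
Lemma nearest_segment x y (tau : R) : is_nearest S x y -> 0 <= tau <= 1 ->
  is_nearest S (y + tau *: (x - y)) y.
Proof.
move=> [Sy ymin] /andP[t0 t1]; split=> // z Sz.
rewrite addrAC subrr add0r l2normZ ger0_norm //.
have := l2normD (y + tau *: (x - y) - z) ((1 - tau) *: (x - y)).
have -> : y + tau *: (x - y) - z + (1 - tau) *: (x - y) = x - z.
  by apply/matrixP => i j; rewrite !mxE; ring.
by rewrite l2normZ ger0_norm ?subr_ge0 //; have := ymin _ Sz; lra.
Qed.

End Manifold.

(** * Dissipation and speed estimates at one point of the tube *)

Section Dissipation.
Context {R : realType} {d s m k : nat} {E : 'cV[R]_d -> R} {S : set 'cV[R]_d}.
Context {delta M L mu alpha : R}.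
Hypotheses (E2 : C2_on setT E) (Ssad : critical_saddle_manifold E s m S).
Hypothesis Stube : standing_assumption E s m S delta M L mu.
Hypothesis alpha_lt : alpha < 3 * mu ^+ 2 / (64 * L ^+ 2).

Context {x y : 'cV[R]_d} {v : 'I_k -> 'cV[R]_d}.
Hypotheses (xy : is_nearest S x y) (xy_delta : l2norm (x - y) < delta).
Hypothesis vclose : directions_close (hess E x) s m alpha v.

Let r := x - y.
Let Q := 1%:M - \sum_p 2 *: (v p *m (v p)^T).

Lemma reflect_tr : Q^T = Q.
Proof.
rewrite /Q linearB /= trmx1 linear_sum /=; congr (_ - _); apply: eq_bigr => p _.
by rewrite linearZ /= trmx_mul trmxK.
Qed.

Lemma reflect_decomp (P : 'M[R]_d) :
  Q = (1%:M - 2 *: P) - 2 *: (\sum_p v p *m (v p)^T - P).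
Proof. by rewrite /Q -scaler_sumr scalerBr opprB addrA subrK. Qed.

(** The exact reflection is an isometry, and [vclose] bounds the remaining term by 2 alpha. *)
Lemma l2norm_reflect_le z : l2norm (Q *m z) <= (1 + 2 * alpha) * l2norm z.
Proof.
have [u [w [[uo _] wo wmid close]]] := vclose.
set P := \sum_(i < d | (i < s)%N) u i *m (u i)^T + \sum_p w p *m (w p)^T.
rewrite (reflect_decomp P) mulmxBl -scalemxAl.
apply: le_trans (l2normD _ _) _; rewrite l2normN l2normZ (l2norm_saddle_reflect uo wo wmid).
rewrite ger0_norm // [leRHS]mulrDl mul1r lerD2l -mulrA ler_wpM2l // /P opprD addrA.
by apply: le_trans (l2norm_mulmx _ _) _; rewrite ler_wpM2r ?l2norm_ge0 // ltW.
Qed.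

Lemma tube_segment (tau : R) : 0 <= tau <= 1 -> tube S delta (y + tau *: r).
Proof.
move=> t01; exists y; first exact: nearest_segment.
have /andP[t0 t1] := t01; rewrite addrAC subrr add0r l2normZ ger0_norm //.
by apply: le_lt_trans xy_delta; rewrite ler_piMl ?l2norm_ge0.
Qed.

Lemma tube_x : tube S delta x.
Proof. by exists y. Qed.

Lemma hess_segment (tau : R) : 0 <= tau <= 1 ->
  spectral_norm (hess E x - hess E (y + tau *: r)) <= mu / 4.
Proof.
move=> t01; have [[_ M0 _ _ Md] [_ lip _]] := Stube.
apply: le_trans (lip _ _ tube_x (tube_segment _ t01)) (le_trans _ Md).
rewrite ler_wpM2l ?(ltW M0) //.
have -> : x - (y + tau *: r) = (1 - tau) *: r.
  by rewrite /r; apply/matrixP => i j; rewrite !mxE; ring.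
have /andP[t0 t1] := t01; rewrite l2normZ ger0_norm ?subr_ge0 //.
apply: le_trans (ltW xy_delta); rewrite ler_piMl ?l2norm_ge0 //; lra.
Qed.

Lemma critical z : S z -> grad E z = 0.
Proof. by have [_ _ _ /(_ z)] := Ssad => /[apply] -[[]]. Qed.

(** The mean value formula gives <r, X Q r>, with X the Hessian at a point of the segment. Replacing
    X by H costs (1/4)(1 + 2 alpha), and Q by the exact reflection 2 alpha L / mu, in units of mu
    |r|^2. What remains is at least 23/27 - 6/64 - (1/4)(1 + 6/64) > 1/4. *)
Lemma dissipation : mu / 4 * l2norm r ^+ 2 <= dotv r (Q *m grad E x).
Proof.
have [[d0 M0 L0 mu0 Md] [_ _ eigs]] := Stube.
have [u [w [[uo Hu] wo wmid close]]] := vclose.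
have [_ _ emb _] := Ssad.
have Sy : S y by case: xy.
have [D [Dinj Dtan]] := tangent_frame y emb Sy.
have lam_lo i := (eigs x tube_x i).1; have lam_hi i := (eigs x tube_x i).2.
have seg0 := hess_segment 0; rewrite scale0r addr0 lexx ler01 in seg0.
have Hy_tan w' := hess_tangent _ _ E2 critical (Dtan w').
have [tau t01 mvt] := grad_mvt _ y r (Q *m r) E2.
have segX := hess_segment _ t01.
rewrite -reflect_tr -dotv_mulmxl.
move: mvt; rewrite [y + r]addrC subrK (critical _ Sy) dotv0r subr0 => ->.
move: (hess E x) (hess E y) (hess E (y + tau *: r)) Hu lam_lo lam_hi seg0 Hy_tan segX.
move=> H Hy X {}Hu lam_lo lam_hi /(_ isT) seg0 Hy_tan segX.
have Hsym : H^T = H := eigen_selfadjoint uo Hu.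
have rD z : dotv r (D *m z) = 0.
  have h1 := nearest_dotv_tangent _ _ _ xy (Dtan z).
  have := nearest_dotv_tangent _ _ _ xy (Dtan (- z)); rewrite mulmxN dotvNr.
  by rewrite -/r in h1 *; lra.
(* It is Hy^T that kills tangent vectors, so the difference H - Hy appears transposed. *)
have HD z : l2norm (H *m (D *m z)) <= mu / 4 * l2norm (D *m z).
  have -> : H *m (D *m z) = (H - Hy)^T *m (D *m z).
    by rewrite trmxB mulmxBl Hsym Hy_tan subr0.
  apply: le_trans (l2norm_trmx_mulmx _ _) _; rewrite ler_wpM2r ?l2norm_ge0 //.
(* The comparison mu <= L below requires r to be nonzero. *)
have [r0|r0] := eqVneq r 0; first by rewrite r0 l2norm0 dotv0l expr0n mulr0.
have muL : mu <= L := mu_le_L L0 mu0 uo Hu lam_lo lam_hi Dinj rD HD r0.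
have HrL := l2norm_eigen_mulmx L0 mu0 uo Hu lam_lo lam_hi Dinj rD HD.
have coer := saddle_reflect_coercive L0 mu0 uo Hu lam_lo lam_hi wo wmid Dinj rD HD.
have rho0 := l2norm_ge0 r; set rho := l2norm r in rho0 HrL coer *.
(* alpha L^2 < 3/64 mu^2 <= 3/64 mu L; divide by L. *)
have alphaL : alpha * L <= 3 / 64 * mu.
  have L2 : 0 < 64 * L ^+ 2 by rewrite mulr_gt0 ?exprn_gt0.
  move: alpha_lt; rewrite ltr_pdivlMr // => aL.
  rewrite -(ler_pM2r L0); have := ler_wpM2l (ltW mu0) muL.
  by rewrite !expr2 in aL; lra.
have alpha1 : alpha <= 3 / 64.
  rewrite -(ler_pM2r L0); apply: le_trans alphaL _; lra.
have alpha0 : 0 <= alpha by apply: le_trans (spectral_norm_ge0 _) (ltW close).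
have zle := l2norm_reflect_le r; rewrite -/rho in zle.
have -> : X = H - (H - X) by rewrite subKr.
rewrite mulmxBl dotvBr.
have err : dotv r ((H - X) *m (Q *m r)) <= mu / 4 * rho * ((1 + 2 * alpha) * rho).
  apply: le_trans (ler_norm _) _; apply: le_trans (cauchy_schwarz_mulmx _ _ _) _.
  apply: ler_pM; rewrite ?mulr_ge0 ?spectral_norm_ge0 ?l2norm_ge0 //.
  by rewrite ler_wpM2r.
rewrite dotv_mulmxr Hsym.
set P := \sum_(i < d | (i < s)%N) u i *m (u i)^T + \sum_p w p *m (w p)^T in coer.
have -> : dotv (H *m r) (Q *m r) = dotv (H *m r) ((1%:M - 2 *: P) *m r) -
    2 * dotv (H *m r) ((\sum_p v p *m (v p)^T - P) *m r).
  by rewrite {1}(reflect_decomp P) mulmxBl dotvBr -scalemxAl dotvZr.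
have perturb : dotv (H *m r) ((\sum_p v p *m (v p)^T - P) *m r) <= L * rho * (alpha * rho).
  apply: le_trans (le_dotv _ _) _; apply: ler_pM; rewrite ?l2norm_ge0 //.
  rewrite /P opprD addrA; apply: le_trans (l2norm_mulmx _ _) _.
  by rewrite ler_wpM2r ?l2norm_ge0 ?ltW.
have rr := sqr_ge0 rho.
have b1 : L * rho * (alpha * rho) <= 3 / 64 * mu * rho ^+ 2.
  by have := ler_wpM2r rr alphaL; rewrite expr2; lra.
have b2 : mu / 4 * rho * ((1 + 2 * alpha) * rho) <= mu / 4 * (1 + 6 / 64) * rho ^+ 2.
  have : mu / 4 * rho ^+ 2 * (1 + 2 * alpha) <= mu / 4 * rho ^+ 2 * (1 + 6 / 64).
    by rewrite ler_wpM2l //; [rewrite mulr_ge0 //; lra | lra].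
  by rewrite expr2; lra.
have := mulr_ge0 (ltW mu0) rr; lra.
Qed.

(** With e_j the j-th basis vector, the coordinate is <Q e_j, grad E x> = <r, X Q e_j> for a Hessian
    X on the segment, and |Q e_j| <= 1 + 2 alpha. *)
Lemma velocity_bound (C : R) (j : 'I_d) : (forall z, spectral_norm (hess E z) <= C) ->
  `|(Q *m grad E x) j 0| <= C * (1 + 2 * alpha) * l2norm r.
Proof.
move=> hC; have [Sy _] := xy.
rewrite -dotv_delta dotvC dotv_mulmxr reflect_tr.
have [tau t01 e] := grad_mvt _ y r (Q *m delta_mx j 0) E2.
move: e; rewrite [y + r]addrC subrK (critical _ Sy) dotv0r subr0 => ->.
apply: le_trans (cauchy_schwarz_mulmx _ _ _) _.
rewrite mulrAC ler_wpM2r ?l2norm_ge0 //.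
apply: ler_pM; rewrite ?spectral_norm_ge0 ?l2norm_ge0 //.
apply: le_trans (l2norm_reflect_le _) _.
by rewrite /l2norm dotv_delta mxE !eqxx sqrtr1 mulr1.
Qed.

End Dissipation.

(** * Functions of one real variable: monotonicity and exponential decay *)

Section RealLemmas.
Context {R : realType}.
Implicit Types f F G : R -> R.

(* If [F b > F a], then at a minimum of [F] minus its chord the support [G] would
   have slope at least that of the chord, which is positive. *)
Lemma supported_decrease F a b : a < b -> {within `[a, b], continuous F} ->
  (forall t, a <= t < b -> exists G l, [/\ is_derive t 1 G l, l <= 0, G t = F t &
     forall s, a <= s <= b -> F s <= G s]) ->
  F b <= F a.
Proof.
move=> ab cF supp; rewrite leNgt; apply/negP => Fab.
pose sigma := (F b - F a) / (b - a).
have ba : 0 < b - a by rewrite subr_gt0.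
have sigma_gt0 : 0 < sigma by rewrite divr_gt0 // subr_gt0.
pose g t := F t - sigma * t.
have gab : g a = g b by rewrite /g /sigma; field; rewrite gt_eqF.
have cg : {within `[a, b], continuous g}.
  move=> t; apply: continuousB; first exact: cF.
  by apply: continuous_subspaceT => u; exact: scaler_continuous.
have [c cab gmin] := EVT_min (ltW ab) cg.
(* Since g a = g b, a minimum at b can be moved to a, which leaves room on its right. *)
have {c cab gmin} [c cab gmin] : exists2 c, a <= c < b & forall t, a <= t <= b -> g c <= g t.
  have gmin' t : a <= t <= b -> g c <= g t by move=> tab; apply: gmin; rewrite in_itv.
  move: cab; rewrite in_itv /= => /andP[ac cb].
  have [ceb|cneb] := eqVneq c b.
    exists a; first by rewrite lexx ab.
    by move=> t tab; rewrite gab -[in leLHS]ceb; exact: gmin'.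
  by exists c => //; rewrite ac lt_neqAle cneb cb.
have [G [l [dG l0 Gc FG]]] := supp c cab.
have /andP[ac cb] := cab; suff : sigma <= l by lra.
apply: (derive_right_ge _ _ _ _ dG); near=> h.
have h0 : 0 < h by near: h; exact: nbhs_right_gt.
have hb : h < b - c by near: h; apply: nbhs_right_lt; rewrite subr_gt0.
have chab : a <= c + h <= b by apply/andP; split; lra.
by have := gmin _ chab; have := FG _ chab; rewrite /g Gc; lra.
Unshelve. all: by end_near. Qed.

Lemma is_derive_expRM (c u : R) :
  is_derive u 1 (fun t : R => expR (c * t)) (expR (c * u) * c).
Proof.
have d1 : is_derive u 1 (fun t : R => c * t) c.
  by apply: (is_derive_eq (is_deriveZ c (is_derive_id u 1))); rewrite -[LHS]/(c * 1) mulr1.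
exact: (is_derive1_comp (is_derive_expR (c * u)) d1).
Qed.

Lemma continuous_expRM (c : R) : continuous (fun t : R => expR (c * t)).
Proof.
move=> t; have [de _] := is_derive_expRM c t.
exact/differentiable_continuous/derivable1_diffP.
Qed.

(** The derivative of f - (K / kappa) exp(- kappa t) is df + K exp(- kappa t), which is
    nonnegative. *)
Lemma exp_decay_mono f (df : R -> R) (K kappa : R) : 0 < kappa ->
  (forall t : R, 0 < t -> is_derive t 1 f (df t)) ->
  (forall t : R, 0 < t -> `|df t| <= K * expR (- kappa * t)) ->
  forall s t : R, 0 < s -> s <= t ->
  f s - K / kappa * expR (- kappa * s) <= f t - K / kappa * expR (- kappa * t).
Proof.
move=> k0 fdf dfK s t s0 st.
pose h u := f u - K / kappa * expR (- kappa * u).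
have dh (u : R) : 0 < u -> is_derive u 1 h (df u + K * expR (- kappa * u)).
  move=> /fdf dfu; rewrite /h.
  have de : is_derive u 1 (fun u : R => expR (- kappa * u)) (expR (- kappa * u) * - kappa).
    exact: is_derive_expRM.
  have := is_deriveB dfu (@is_deriveZ _ _ _ _ (K / kappa) _ _ _ de).
  move=> d1; apply: (is_derive_eq d1).
  by rewrite -[_ *: _]/(_ * _); field; rewrite gt_eqF.
have := @ger0_derive1_ndecr _ h s t; apply => //.
- move=> u; rewrite in_itv /= => /andP[su _].
  by have [] := dh u (lt_trans s0 su).
- move=> u; rewrite in_itv /= => /andP[su _].
  have u0 := lt_trans s0 su.
  rewrite derive1E; have [_ ->] := dh u u0.
  by have := dfK u u0; rewrite ler_norml => /andP[+ _]; lra.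
- apply: derivable_within_continuous => u; rewrite in_itv /= => /andP[su _].
  by have [] := dh u (lt_le_trans s0 su).
Qed.

Lemma cvg_expR_decay (B kappa : R) : 0 < kappa ->
  B * expR (- kappa * t) @[t --> +oo] --> (0 : R).
Proof.
move=> k0; have -> : (fun t => B * expR (- kappa * t)) =
    (fun t => B * (((fun x => expR (- x)) \o ( *%R kappa)) t)).
  by apply/funext => t /=; rewrite mulNr.
rewrite -[X in _ --> X](mulr0 B); apply: cvgM; first exact: cvg_cst.
apply: (@cvg_comp _ _ _ ( *%R kappa) (fun x => expR (- x)) _ +oo); last exact: cvgr_expR.
by apply: gt0_cvgMry => //; exact: cvg_id.
Qed.

(** f minus the exponential is nondecreasing, and bounded above by the same estimate for -f, so it
    converges; the exponential tends to 0. *)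
Lemma exp_decay_cvg f (df : R -> R) (K kappa : R) : 0 < kappa ->
  (forall t : R, 0 < t -> is_derive t 1 f (df t)) ->
  (forall t : R, 0 < t -> `|df t| <= K * expR (- kappa * t)) ->
  cvg (f t @[t --> +oo]).
Proof.
move=> k0 fdf dfK.
have m1 := exp_decay_mono _ _ _ _ k0 fdf dfK.
have m2 := exp_decay_mono (- f) (fun t => - df t) K kappa k0.
have {}m2 s t : 0 < s -> s <= t ->
    f t + K / kappa * expR (- kappa * t) <= f s + K / kappa * expR (- kappa * s).
  move=> s0 st; have := m2 _ _ s t s0 st; rewrite /GRing.opp /=.
  move=> h; suff: - f s - K / kappa * expR (- kappa * s) <= - f t - K / kappa * expR (- kappa * t) by lra.
  by apply: h => u u0; [apply: is_deriveN; exact: fdf|rewrite normrN; exact: dfK].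
have K0 : 0 <= K.
  by have := le_trans (normr_ge0 _) (dfK 1 ltr01); rewrite pmulr_lge0 // expR_gt0.
pose h u := f u - K / kappa * expR (- kappa * u).
(* Monotonicity is known for positive times only; freezing h before time 1 makes it monotone on the
   whole line. *)
pose hm u := h (Order.max 1 u).
have hm_nd : nondecreasing_fun hm.
  move=> u v uv; apply: m1; first by rewrite lt_max ltr01.
  by rewrite ge_max le_max lexx /= le_max uv orbT.
have hm_ub : has_ubound (range hm).
  exists (f 1 + K / kappa * expR (- kappa * 1)) => _ [u _ <-].
  have u1 : 1 <= Order.max 1 u by rewrite le_max lexx.
  apply: le_trans (m2 _ _ ltr01 u1); rewrite /hm /h.
  have : 0 <= K / kappa * expR (- kappa * Order.max 1 u).
    by rewrite mulr_ge0 ?expR_ge0 // divr_ge0 // ltW.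
  lra.
have hc := nondecreasing_cvgr hm_nd hm_ub.
have ec := cvg_expR_decay (K / kappa) kappa k0.
apply/cvg_ex; exists (sup (range hm) + 0); apply: cvg_trans (cvgD hc ec).
apply: near_eq_cvg; near=> u.
have u1 : 1 <= u by near: u; exact: nbhs_pinfty_ge.
by rewrite -[LHS]/(hm u + _) /hm /h (max_idPr u1) subrK.
Unshelve. all: by end_near. Qed.

End RealLemmas.

(** * The distance to a set and its nearest points *)

Section Distance.
Context {R : realType} {d : nat} {S : set 'cV[R]_d}.
Implicit Types x y z : 'cV[R]_d.

(** The ambient topology is that of the sup norm, so continuity goes through the coordinates. *)
Lemma l2norm_continuous : continuous (@l2norm R d).
Proof.
move=> x; rewrite /l2norm /dotv.
apply: (@continuous_comp _ _ _ (fun x => \sum_i x i 0 * x i 0) Num.sqrt); last exact: sqrt_continuous.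
have c i : continuous (fun z : 'cV[R]_d => z i 0 * z i 0).
  move=> z; have cz := differentiable_continuous (@differentiable_coord R d 1 z i 0).
  exact: (cvgM cz cz).
by apply: (continuous_big (P := xpredT)) => [|i _]; [exact: add_continuous|exact: c].
Qed.

Lemma cvg_l2normB {T : Type} {F : set_system T} {FF : Filter F} (f : T -> 'cV[R]_d) x y :
  f t @[t --> F] --> x -> l2norm (f t - y) @[t --> F] --> l2norm (x - y).
Proof.
move=> fx; have fxy : f t - y @[t --> F] --> x - y.
  by apply: cvgB => //; exact: cvg_cst.
have c : l2norm z @[z --> x - y] --> l2norm (x - y) by exact: l2norm_continuous.
exact: cvg_comp _ _ fxy c.
Qed.

Lemma dist_to_has_lbound x : has_lbound [set l2norm (x - y) | y in S].
Proof. by exists 0 => _ [y _ <-]; exact: l2norm_ge0. Qed.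

Lemma dist_to_le x y : S y -> dist_to S x <= l2norm (x - y).
Proof. by move=> Sy; apply: (ge_inf (dist_to_has_lbound x)); exists y. Qed.

Lemma dist_toE x y : is_nearest S x y -> dist_to S x = l2norm (x - y).
Proof.
move=> [Sy ymin]; apply/eqP; rewrite eq_le dist_to_le //=.
by apply: lb_le_inf; [exists (l2norm (x - y)), y|move=> _ [z Sz <-]; exact: ymin].
Qed.

Lemma dist_to_lipschitz x z y : is_nearest S z y ->
  dist_to S x <= dist_to S z + l2norm (x - z).
Proof.
move=> zy; rewrite (dist_toE _ _ zy); apply: le_trans (dist_to_le x y zy.1) _.
by have := l2normD (x - z) (z - y); rewrite addrA subrK; lra.
Qed.

End Distance.

(** * Decay of the distance and convergence along a trajectory *)

Section Trajectory.
Context {R : realType} {d s m k : nat} {E : 'cV[R]_d -> R} {S : set 'cV[R]_d}.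
Context {delta M L mu beta zeta alpha C : R} {theta : R -> 'cV[R]_d}.
Hypotheses (E2 : C2_on setT E) (Ssad : critical_saddle_manifold E s m S).
Hypothesis hess_le : forall x, spectral_norm (hess E x) <= C.
Hypothesis Stube : standing_assumption E s m S delta M L mu.
Hypothesis beta_gt0 : 0 < beta.
Hypothesis alpha_lt : alpha < 3 * mu ^+ 2 / (64 * L ^+ 2).
Hypothesis traj : admissible_trajectory E S s m k delta beta zeta alpha theta.

(** The decay rate of the distance; its square decays at rate 2 kappa. *)
Let kappa := beta * mu / 4.
Let rho t := dist_to S (theta t).

Lemma kappa_gt0 : 0 < kappa.
Proof. by have [[_ _ _ mu0 _] _] := Stube; rewrite divr_gt0 // mulr_gt0. Qed.

Lemma traj_nearest t : 0 <= t -> exists2 y, is_nearest S (theta t) y & l2norm (theta t - y) < delta.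
Proof. by move=> t0; have [v [_ + _]] := traj => /(_ t t0). Qed.

Lemma traj_derive t : 0 < t -> exists v : 'I_k -> 'cV[R]_d,
  directions_close (hess E (theta t)) s m alpha v /\
  is_derive t 1 theta
   (- beta *: ((1%:M - \sum_p 2 *: (v p *m (v p)^T)) *m grad E (theta t))).
Proof.
move=> t0; have [v [[_ _ dth _ _] _ close]] := traj.
by exists (v^~ t); split; [exact: close (ltW t0)|exact: dth].
Qed.

Lemma rho_ge0 t : 0 <= t -> 0 <= rho t.
Proof. by move=> /traj_nearest[y yn _]; rewrite /rho (dist_toE _ _ yn) l2norm_ge0. Qed.

Lemma rho_continuous (t : R) : 0 < t -> {for t, continuous rho}.
Proof.
move=> t0.
have cth : theta u @[u --> t] --> theta t.
  have [v [_ [dth _]]] := traj_derive t t0.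
  by apply: differentiable_continuous; apply/derivable1_diffP.
have c0 : l2norm (theta u - theta t) @[u --> t] --> (0 : R).
  by rewrite -(@l2norm0 R d) -(subrr (theta t)); exact: cvg_l2normB.
apply/cvgrPdist_le => e e0; near=> u.
have u0 : 0 < u by near: u; exact: lt_nbhsr.
have [y yn _] := traj_nearest t (ltW t0); have [z zn _] := traj_nearest u (ltW u0).
have h1 := dist_to_lipschitz (theta u) _ _ yn.
have h2 := dist_to_lipschitz (theta t) _ _ zn; rewrite l2normB in h2.
have : l2norm (theta u - theta t) <= e.
  apply: le_trans (ler_norm _) _; rewrite -[X in `|X|]subr0 distrC.
  by near: u; exact: (cvgr_dist_le _ _ c0).
by rewrite ler_norml /rho => h3; apply/andP; split; lra.
Unshelve. all: by end_near. Qed.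

(** Freezing the nearest point y of theta t gives a differentiable G above the energy, equal to it
    at t. Its slope is nonpositive, since [dissipation] yields beta <r, g> >= kappa |r|^2 with r =
    theta t - y. *)
Lemma energy_decrease (a b : R) : 0 < a -> a <= b ->
  rho b ^+ 2 * expR (2 * kappa * b) <= rho a ^+ 2 * expR (2 * kappa * a).
Proof.
move=> a0; rewrite le_eqVlt => /orP[/eqP<-//|ab].
apply: (@supported_decrease R (fun t => rho t ^+ 2 * expR (2 * kappa * t))) => //.
  apply: continuous_in_subspaceT => t; rewrite inE /= in_itv /= => /andP[at_ _].
  have t0 := lt_le_trans a0 at_.
  apply: cvgM.
    by rewrite /= -[rho t ^+ 2]/(rho t * rho t); apply: cvgM; exact: rho_continuous.
  exact: continuous_expRM.
move=> t /andP[at_ tb]; have t0 := lt_le_trans a0 at_.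
have [y yn yd] := traj_nearest t (ltW t0).
have [v [close dth]] := traj_derive t t0.
pose G u := l2norm (theta u - y) ^+ 2 * expR (2 * kappa * u).
have diss := dissipation E2 Ssad Stube alpha_lt yn yd close.
set g := _ *m grad E (theta t) in dth diss.
have dB : is_derive t 1 (fun u => theta u - y) (- beta *: g).
  by have := is_deriveB dth (is_derive_cst y t 1); rewrite subr0.
pose l := 2 * expR (2 * kappa * t) *
  (kappa * l2norm (theta t - y) ^+ 2 - beta * dotv (theta t - y) g).
have dG : is_derive t 1 G l.
  apply: (is_derive_eq (is_deriveM (is_derive_l2norm_sqr _ _ _ dB)
    (is_derive_expRM (2 * kappa) t))).
  by rewrite dotvZr /l -![_ *: _]/(_ * _); ring.
exists G, l; split => //.
- have bd := ler_wpM2l (ltW beta_gt0) diss.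
  rewrite /l mulr_ge0_le0 ?mulr_ge0 ?expR_ge0 // /kappa; lra.
- by rewrite /G /rho (dist_toE _ _ yn).
- move=> u /andP[au ub]; rewrite /G ler_wpM2r ?expR_ge0 //.
  have [u0 Sy] := (lt_le_trans a0 au, yn.1).
  by rewrite ler_sqr ?nnegrE ?l2norm_ge0 ?rho_ge0 ?(ltW u0) // dist_to_le.
Qed.

(** The equations hold at positive times, so [energy_decrease] is used from a > 0 and a tends to 0.
    There rho a is at most |theta a - y|, with y nearest to theta 0, and this tends to rho 0. *)
Lemma rho_decay t : 0 <= t -> rho t <= rho 0 * expR (- kappa * t).
Proof.
rewrite le_eqVlt => /orP[/eqP<-|t0]; first by rewrite mulr0 expR0 mulr1.
have [y yn _] := traj_nearest 0 (lexx 0); have Sy := yn.1.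
suff h : rho t ^+ 2 * expR (2 * kappa * t) <= rho 0 ^+ 2.
  have -> : expR (- kappa * t) = (expR (kappa * t))^-1 by rewrite mulNr expRN.
  rewrite ler_pdivlMr ?expR_gt0 //.
  rewrite -ler_sqr ?nnegrE ?mulr_ge0 ?expR_ge0 ?rho_ge0 ?(ltW t0) //.
  by rewrite exprMn [expR _ ^+ 2]expr2 -expRD; apply: le_trans h; rewrite -mulrDl -mulr2n mulr_natl.
have cth : theta u @[u --> 0^'+] --> theta 0.
  by have [v [[/continuous_within_itvcyP[]]]] := traj.
have c2 : l2norm (theta u - y) @[u --> 0^'+] --> l2norm (theta 0 - y) by exact: cvg_l2normB.
have ec : expR (2 * kappa * u) @[u --> 0^'+] --> expR (2 * kappa * 0).
  by apply: cvg_at_right_filter; exact: continuous_expRM.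
have c1 : l2norm (theta u - y) ^+ 2 * expR (2 * kappa * u) @[u --> 0^'+] --> rho 0 ^+ 2.
  have := cvgM (cvgM c2 c2) ec; rewrite mulr0 expR0 mulr1 /rho (dist_toE _ _ yn).
  exact.
apply: (cvgr_to_ge c1); near=> a.
have a0 : 0 < a by near: a; exact: nbhs_right_gt.
have at_ : a <= t by near: a; exact: nbhs_right_le.
apply: le_trans (energy_decrease _ _ a0 at_) _; rewrite ler_wpM2r ?expR_ge0 //.
by rewrite ler_sqr ?nnegrE ?l2norm_ge0 ?rho_ge0 ?(ltW a0) // dist_to_le.
Unshelve. all: by end_near. Qed.

Lemma rho_nonincreasing t : 0 <= t -> rho t <= rho 0.
Proof.
move=> t0; apply: le_trans (rho_decay _ t0) _.
rewrite ler_piMr ?rho_ge0 // -expR0 ler_expR mulNr oppr_le0.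
by rewrite mulr_ge0 // ltW // kappa_gt0.
Qed.

Lemma rho_cvg0 : rho t @[t --> +oo] --> (0 : R).
Proof.
apply: (squeeze_cvgr (f := fun=> 0) (h := fun t => rho 0 * expR (- kappa * t))).
- near=> t; have t0 : 0 <= t by near: t; exact: nbhs_pinfty_ge.
  by rewrite rho_ge0 // rho_decay.
- exact: cvg_cst.
- exact/cvg_expR_decay/kappa_gt0.
Unshelve. all: by end_near. Qed.

(** By [velocity_bound] the speed is at most a constant times rho, which decays exponentially. *)
Lemma coord_cvg (j : 'I_d) : cvg (theta t j 0 @[t --> +oo]).
Proof.
have [[_ _ L0 mu0 _] _] := Stube.
pose K := beta * (C * (1 + 2 * alpha)) * rho 0.
apply: (@exp_decay_cvg R _ (fun t => ('D_1 theta t) j 0) K kappa kappa_gt0) => t t0.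
  by have [v [_ [dth _]]] := traj_derive t t0; apply: is_derive_coord; exact: derivableP.
have [v [close [_ ->]]] := traj_derive t t0.
have [y yn yd] := traj_nearest t (ltW t0).
rewrite mxE normrM normrN (ger0_norm (ltW beta_gt0)).
have := velocity_bound E2 Ssad yn close C j hess_le; rewrite -(dist_toE _ _ yn) => h.
rewrite /K -mulrA -mulrA ler_wpM2l ?(ltW beta_gt0) //; apply: le_trans h _.
have A0 : 0 <= alpha.
  by have [u [w [_ _ _ /ltW]]] := close; apply: le_trans; exact: spectral_norm_ge0.
rewrite ler_wpM2l ?rho_decay ?(ltW t0) // mulr_ge0 //; last by lra.
exact: le_trans (spectral_norm_ge0 _) (hess_le 0).
Qed.

(** The coordinatewise limit x is also the limit of the nearest points, as rho tends to 0; these lie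
    in the closed set S. *)
Lemma traj_cvg : exists2 x, S x & theta t @[t --> +oo] --> x.
Proof.
pose x : 'cV[R]_d := \col_j lim (theta t j 0 @[t --> +oo]).
have cx : theta t @[t --> +oo] --> x.
  apply/cvg_mx_entourageP => A entA.
  have : \forall t \near +oo, forall i : 'I_d, A (x i 0, theta t i 0).
    apply: filter_forall => i; rewrite mxE.
    by move/cvg_entourageP: (coord_cvg i) => /(_ A entA).
  by apply: filterS => t At i j; rewrite ord1 inE.
exists x => //.
have [clS _ _ _] := Ssad.
(* The default 0 can occur only for t < 0. *)
pose y t := xget 0 [set y | is_nearest S (theta t) y].
have yP t : 0 <= t -> is_nearest S (theta t) (y t).
  by move=> /traj_nearest[z zn _]; apply: (xgetPex 0); exists z.
have yS : \forall t \near +oo, S (y t).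
  near=> t; have t0 : 0 <= t by near: t; exact: nbhs_pinfty_ge.
  by have [] := yP t t0.
suff cy : y t @[t --> +oo] --> x by exact: (closed_cvg _ clS yS _ cy).
suff : theta t - y t @[t --> +oo] --> (0 : 'cV[R]_d).
  move=> h; have hc := cvgB cx h; rewrite subr0 in hc.
  have -> : y = theta \- (theta \- y) by apply/funext => t /=; rewrite subKr.
  exact: hc.
apply/cvgrPdist_le => e e0; near=> t.
have t0 : 0 <= t by near: t; exact: nbhs_pinfty_ge.
rewrite sub0r normrN [leLHS]/Num.Def.normr /= mx_normrE (bigmax_le _ (ltW e0)) //= => -[i j] _.
rewrite ord1; apply: le_trans (coord_le_l2norm _ _) _.
rewrite -(dist_toE _ _ (yP t t0)); apply: le_trans (ler_norm _) _.
rewrite -[X in `|X|]subr0 distrC; near: t.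
exact: (cvgr_dist_le _ _ rho_cvg0).
Unshelve. all: by end_near. Qed.

End Trajectory.

Theorem theorem3p11 (R : realType) (d s m k : nat)
    (E : 'cV[R]_d -> R) (Mf : set 'cV[R]_d)
    (delta M L mu beta zeta alpha : R) (theta : R -> 'cV[R]_d)
    (E_C2 : C2_on setT E)
    (hess_bounded : exists C : R, forall x, spectral_norm (hess E x) <= C)
    (Mf_saddles : critical_saddle_manifold E s m Mf)
    (Mf_tube : standing_assumption E s m Mf delta M L mu)
    (s_le_k : (s <= k)%N) (k_le_sm : (k <= s + m)%N)
    (beta_gt0 : 0 < beta) (zeta_gt0 : 0 < zeta)
    (alpha_lt : alpha < 3 * mu ^+ 2 / (64 * L ^+ 2))
    (theta_traj : admissible_trajectory E Mf s m k delta beta zeta alpha theta) :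
  asymptotically_stable Mf
    [set x | admissible_trajectory E Mf s m k delta beta zeta alpha x] /\
  exists vartheta : 'cV[R]_d,
    [/\ Mf vartheta, index_saddle E s vartheta &
        theta t @[t --> +oo] --> vartheta].
Proof.
split.
  split=> [eps eps0|].
    (* The distance never exceeds its initial value, so eta = eps works. *)
    exists eps => // x xtraj xeps t t0; apply: le_lt_trans xeps.
    exact: (rho_nonincreasing E_C2 Mf_saddles Mf_tube beta_gt0 alpha_lt xtraj).
  (* The radius 1 is arbitrary: the distance tends to 0 along every admissible trajectory. *)
  exists 1 => // x xtraj _.
  exact: (rho_cvg0 E_C2 Mf_saddles Mf_tube beta_gt0 alpha_lt xtraj).
have [C hessC] := hess_bounded.
have [x Sx cx] := traj_cvg E_C2 Mf_saddles hessC Mf_tube beta_gt0 alpha_lt theta_traj.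
by exists x; split=> //; have [_ _ _ /(_ x Sx)[]] := Mf_saddles.
Qed.
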